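(* Let $S_1,S_2\subseteq\mathbb{F}_q$ with $\#S_1=\#S_2=s$, let $0\le i\le j<s$, and let $$L_1=\{N\in\Delta(s,s)\mid N\preceq_{\deg}X^iY^j\},\qquad L_2=\{N\in\Delta(s,s)\mid N\prec_{\deg}X^jY^i\}.$$ Then $C(L_1)$ and $C(L_2)$ have length $n=s^2$ and codimension $\ell=j-i+1$, and $$M_1(C(L_1),C(L_2))=(s-i)(s-j),\qquad M_1(C(L_2)^\perp,C(L_1)^\perp)\ge(i+1)(j+1),$$ and for $v=2,\dots,\ell$, $$M_v(C(L_1),C(L_2))=(s-i)(s-j)+\sum_{t=2}^v\big((s-i)-(t-1)\big)=(s-i)(s-j+v-1)-\frac{v(v-1)}{2},$$ $$M_v(C(L_2)^\perp,C(L_1)^\perp)\ge(i+1)(j+1)+\sum_{t=2}^v\big((j+1)-(t-1)\big)=(i+v)(j+1)-\frac{v(v-1)}{2}.$$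
   Context: $q$ is a prime power. $S_1\times S_2=\{\alpha_1,\dots,\alpha_n\}$, $n=s^2$. $\Delta(s,s)=\{X^aY^b\mid 0\le a,b<s\}$. For $L\subseteq\Delta(s,s)$, $C(L)\subseteq\mathbb{F}_q^n$ is the span of $(N(\alpha_1),\dots,N(\alpha_n))$, $N\in L$; $C^\perp$ is the Euclidean dual. $\prec_{\deg}$ is the degree lexicographic ordering: $X^aY^b\prec_{\deg}X^cY^d$ iff $a+b<c+d$, or $a+b=c+d$ and $b<d$. For linear codes $C_2\subsetneq C_1\subseteq\mathbb{F}_q^n$ and $1\le v\le\dim C_1-\dim C_2$, $M_v(C_1,C_2)=\min\{\#\mathrm{Supp}\,U\mid U\subseteq C_1\text{ subspace},\ \dim U=v,\ U\cap C_2=\{\vec0\}\}$, with $\mathrm{Supp}\,U$ the set of coordinates where some word of $U$ is nonzero. *)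

(* Defs.v *)
From HB Require Import structures.
From mathcomp Require Import all_boot all_order all_algebra all_field.
Set Implicit Arguments. Unset Strict Implicit. Unset Printing Implicit Defensive.
Import GRing.Theory.
Local Open Scope ring_scope.

Section Defs.
Variable F : finFieldType.

Definition pts (S1 S2 : {set F}) : {set F * F} := setX S1 S2.
Definition npts (S1 S2 : {set F}) : nat := #|pts S1 S2|.

Definition evmono (S1 S2 : {set F}) (a b : nat) : 'rV[F]_(npts S1 S2) :=
  \row_(k < npts S1 S2)
     ((enum_val k : F * F).1 ^+ a * (enum_val k : F * F).2 ^+ b).

(* monomials of Delta(s,s) are pairs (a,b) : 'I_s * 'I_s standing for X^a Y^b;
   C(L) is the span of the evaluation vectors of monomials in L *)
Definition evcode (S1 S2 : {set F}) (s : nat) (L : {pred 'I_s * 'I_s})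
  : 'M[F]_(npts S1 S2) :=
  (\sum_(m : 'I_s * 'I_s | m \in L) <<evmono S1 S2 m.1 m.2>>)%MS.

End Defs.

Definition dualcode (F : fieldType) (n : nat) (C : 'M[F]_n) : 'M[F]_n :=
  kermx C^T.

Definition mxsupp (F : fieldType) (v n : nat) (G : 'M[F]_(v, n)) : {set 'I_n} :=
  [set k : 'I_n | [exists r : 'I_v, G r k != 0]].

(* M_v(C1,C2): minimum support size of a v-dimensional subspace U of C1 with
   U cap C2 = 0; U ranges over row spaces of row-free v x n matrices
   (default n if no such subspace exists) *)
Definition relM (F : finFieldType) (n : nat) (C1 C2 : 'M[F]_n) (v : nat) : nat :=
  \big[minn/n]_(G : 'M[F]_(v, n) |
        [&& row_free G, (G <= C1)%MS & (G :&: C2 <= (0 : 'M[F]_n))%MS])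
     #|mxsupp G|.

Definition deglex_le (a b c d : nat) : bool :=
  (a + b < c + d)%N || ((a + b == c + d) && (b <= d))%N.
Definition deglex_lt (a b c d : nat) : bool :=
  (a + b < c + d)%N || ((a + b == c + d) && (b < d))%N.

(* Main.v *)
Require Import Defs.
From HB Require Import structures.
From mathcomp Require Import all_boot all_order all_algebra all_field.
From mathcomp Require Import zify ring.
Import GRing.Theory.
Set Implicit Arguments. Unset Strict Implicit. Unset Printing Implicit Defensive.

(** The evaluation vectors of the monomials of Delta(s,s), ordered by deg-lex,
    give a complete flag [initcode t] of F^n: a monomial outside Delta(s,s)
    reduces to strictly smaller ones, and Lagrange interpolation shows that the
    s^2 vectors span F^n.  Hence every subspace U has exactly dim U leading
    monomials, and, dually, the pairing with U has exactly dim U jumps along the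
    flag.  If U lies in C1 and avoids C2 (resp. lies in C2^perp and avoids
    C1^perp), these monomials all sit on the antidiagonal X^(i+t) Y^(j-t),
    0 <= t <= j - i.  Multiplying by monomials shows that the support of U is at
    least as large as the set of monomials of Delta(s,s) that are multiples
    (footprint bound), resp. divisors (Feng-Rao bound), of one of them.  Such a
    staircase is smallest for consecutive monomials at one end of the
    antidiagonal, and in the primal case products of linear factors attain it. *)

(* An order embedding of the deg-lex order on N^2 into N, since b <= a + b. *)
Definition key (a b : nat) : nat := (a + b) ^ 2 + b.

Lemma key_lt a b c d : (key a b < key c d) = deglex_lt a b c d.
Proof.
rewrite /key /deglex_lt !expnS !expn0 !muln1.
have [lt_cd|lt_ab|e] := ltngtP (a + b) (c + d) => /=; [nia|nia|].
by rewrite e ltn_add2l.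
Qed.

Lemma key_le a b c d : (key a b <= key c d) = deglex_le a b c d.
Proof.
by rewrite leqNgt key_lt /deglex_le /deglex_lt; lia.
Qed.

Lemma leq_key a b c d : a <= c -> b <= d -> key a b <= key c d.
Proof. by move=> ac bd; rewrite key_le /deglex_le; lia. Qed.

(** Deg-lex is a monomial order, so monomials multiply the flag in [initcode_diag]. *)
Lemma ltn_keyD a b c d e f :
  (key (a + e) (b + f) < key (c + e) (d + f)) = (key a b < key c d).
Proof. by rewrite !key_lt /deglex_lt; lia. Qed.

Lemma key_inj a b c d : key a b = key c d -> a = c /\ b = d.
Proof.
move=> e; have := key_le a b c d; have := key_le c d a b.
by rewrite e leqnn /deglex_le; lia.
Qed.

Lemma keyT_inj s : injective (fun m : 'I_s * 'I_s => key m.1 m.2).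
Proof. by move=> [a b] [c d] /= /key_inj [/val_inj -> /val_inj ->]. Qed.

Lemma keyT_lt s (m : 'I_s * 'I_s) : key m.1 m.2 < key s s.
Proof. by case: m => [[a ha] [b hb]] /=; rewrite key_lt /deglex_lt; lia. Qed.

(** * Counting the jumps of a function on the naturals *)

Section Jumps.
Variables (T : finType) (k : T -> nat) (r : nat -> nat) (B : {set T}).

Lemma count_keysS t :
  \sum_(P in B) (k P < t.+1) = \sum_(P in B) (k P < t) + \sum_(P in B) (k P == t).
Proof. by rewrite -big_split; apply: eq_bigr => P _ /=; lia. Qed.

Lemma count_keys_all t : (forall P, P \in B -> k P < t) ->
  \sum_(P in B) (k P < t) = #|B|.
Proof. by move=> lt; rewrite -sum1_card; apply: eq_bigr => P /lt ->. Qed.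

(** By injectivity at most one element of [B] has key [t], so each step of [r] pays for at most one
    unit. *)
Lemma count_jumps_le t : {in B &, injective k} ->
  (forall t, r t <= r t.+1) -> (forall P, P \in B -> r (k P) < r (k P).+1) ->
  \sum_(P in B) (k P < t) <= r t.
Proof.
move=> kinj r_mono r_jump; elim: t => [|t IH]; first by rewrite big1.
rewrite count_keysS.
case: (pickP [pred P in B | k P == t]) => [P /= /andP[PB kPt]|no].
  have kP := eqP kPt; have := r_jump P PB; rewrite kP [X in _ + X](bigD1 P PB) kPt [X in _ + (_ + X)]big1 /=; first lia.
  move=> Q /andP[QB]; apply: contraNeq; rewrite eqb0 negbK -kP => /eqP kQ.
  exact/eqP/kinj.
rewrite [X in _ + X]big1 ?addn0 ?(leq_trans IH) // => P PB.
by have := no P; rewrite /= PB /= => ->.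
Qed.

Lemma count_jumps_ge t :
  (forall t, r t.+1 <= r t + \sum_(P in B) (k P == t)) ->
  r t <= r 0 + \sum_(P in B) (k P < t).
Proof.
move=> r_step; elim: t => [|t IH]; first exact: leq_addr.
by rewrite count_keysS; have := r_step t; lia.
Qed.

End Jumps.

(** * Staircases of monomials *)

Section Counting.

(** The size of a staircase with [v] consecutive corners: a rectangle, then lines of K-1, K-2, ...
    cells. The pair [(K, r)] is [(s - i, s - j)] for the primal codes and [(j + 1, i + 1)] for the
    duals. *)
Definition bnd (K r v : nat) : nat := K * r + \sum_(2 <= t < v.+1) (K - (t - 1)).

Lemma bnd1 K r : bnd K r 1 = K * r.
Proof. by rewrite /bnd big_geq // addn0. Qed.

Lemma bndS K r v : 0 < v -> bnd K r v.+1 = bnd K r v + (K - v).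
Proof. by move=> v0; rewrite /bnd big_nat_recr //= addnA subn1. Qed.

Lemma bnd_double K r v : 0 < v <= K ->
  2 * bnd K r v = 2 * K * r + v.-1 * (2 * K - v).
Proof.
elim: v => // -[_ _|v IH /andP[_ vK]]; first by rewrite bnd1 mul0n; lia.
rewrite bndS // mulnDr IH; last exact: ltnW.
have -> : K = v + 2 + (K - v.+2) by lia.
move: (K - v.+2) => d.
have -> : 2 * (v + 2 + d) - v.+1 = v + 3 + 2 * d by lia.
have -> : 2 * (v + 2 + d) - v.+2 = v + 2 + 2 * d by lia.
have -> : v + 2 + d - v.+1 = d.+1 by lia.
by rewrite /=; lia.
Qed.

Lemma bnd_closed K r v : 0 < v <= K ->
  bnd K r v = K * (r + v - 1) - v * (v - 1) %/ 2.
Proof.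
move=> vK; have := bnd_double r vK.
have ev2 : v * (v - 1) = 2 * (v * (v - 1) %/ 2).
  by rewrite [RHS]mulnC divnK // dvdn2 oddM; case: v vK => // v _; rewrite subn1 /= andNb.
move: (v * (v - 1) %/ 2) ev2 => x; case: v vK => // w /= wK.
have -> : K = w + 1 + (K - w.+1) by lia.
move: (K - w.+1) => d.
have -> : 2 * (w + 1 + d) - w.+1 = w + 1 + 2 * d by lia.
have -> : r + w.+1 - 1 = r + w by lia.
by rewrite subn1 /=; lia.
Qed.

Lemma sum_geq s x : \sum_(0 <= q < s) (x <= q) = s - x.
Proof.
elim: s => [|s IH]; first by rewrite big_geq.
by rewrite big_nat_recr //= IH; lia.
Qed.

Lemma card_geq_ord s x : #|[set q : 'I_s | x <= q]| = s - x.
Proof.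
rewrite -sum_geq big_mkord -sum1_card big_mkcond; apply: eq_bigr => q _.
by rewrite inE; case: ifP.
Qed.

(* Counts the points of [0, M[ x [0, s[ above some (a, c - a) with a in l; the
   bound M is what the induction on l shrinks. *)
Definition count_above (c s M : nat) (l : seq nat) : nat :=
  \sum_(0 <= p < M) \sum_(0 <= q < s) has (fun a => (a <= p) && (c <= q + a)) l.

(** The corner at [m] fills the columns of [m, M[ from height [c - m] upwards; the columns left of
    [m] are left to [l]. *)
Lemma count_above_cons c s M m l : m <= M -> m <= c ->
  (M - m) * (s - (c - m)) + count_above c s m l <= count_above c s M (m :: l).
Proof.
move=> mM mc; rewrite /count_above [X in _ <= X](big_cat_nat (n := m)) //= addnC; apply: leq_add.
  rewrite leq_sum // => p _; apply: leq_sum => q _ /=.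
  by case: (has _ l); rewrite ?orbT.
rewrite -sum_nat_const_nat big_nat [X in _ <= X]big_nat.
apply: leq_sum => p /andP[mp _].
rewrite -sum_geq; apply: leq_sum => q _ /=; rewrite mp /=.
have [le|] := leqP (c - m) q => //; have -> : c <= q + m by lia.
by [].
Qed.

(** The minimum occurs at l = M-1, M-2, ..., where each corner contributes one column. The bound is
    the sum of these heights, doubled to avoid division; the bound on [size l] keeps the
    subtractions from truncating. *)
Lemma count_above_ge i j s M l : j < s -> i <= M -> M <= i + j ->
  sorted gtn l -> all (fun a => i <= a < M) l ->
  size l <= M - i /\
  size l * (2 * (s - j + (M - i)) - size l - 1) <= 2 * count_above (i + j) s M l.
Proof.
move=> js; elim: l M => [|m l IH] M iM Mc //= ml /andP[/andP[im mM] al].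
have alm : all (fun a => i <= a < m) l.
  have gt_m := order_path_min (rev_trans ltn_trans) ml.
  apply/allP=> a al'; have /andP[-> _] := allP al a al'.
  exact: (allP gt_m).
have [||||vm IHm] := IH m; rewrite ?(path_sorted ml) //; try lia.
have := @count_above_cons (i + j) s M m l.
have -> : s - (i + j - m) = s - j + (m - i) by lia.
move: (count_above _ _ M _) (count_above _ _ m _) IHm => X Y IHm.
move=> /(_ (ltnW mM)) H; have {}H := H (leq_trans (ltnW mM) Mc).
split; first lia.
move: (size l) vm IHm => v vm IHm.
have [g gE] : exists g, M = m + g.+1 by exists (M - m).-1; lia.
have [y yE] : exists y, m = i + v + y by exists (m - i - v); lia.
have [r rE] : exists r, s = j + r.+1 by exists (s - j).-1; lia.
have -> : 2 * (s - j + (M - i)) - v.+1 - 1 = 2 * r + v + 2 * y + 2 * g + 2 by lia.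
move: IHm; have -> : 2 * (s - j + (m - i)) - v - 1 = 2 * r + 1 + v + 2 * y by lia.
move: H; have -> : M - m = g.+1 by lia.
have -> : s - j + (m - i) = r + 1 + v + y by lia.
have := leq0n (g * (r + y)); clear; lia.
Qed.

(** The first corner is treated apart: its columns extend to [s], while those of a later corner stop
    at the preceding one. *)
Lemma bnd_le_count_above i j s l : j < s -> sorted gtn l -> l != [::] ->
  all (fun a => i <= a <= j) l ->
  bnd (s - i) (s - j) (size l) <= count_above (i + j) s s l.
Proof.
move=> js; case: l => // m l ml _ /= /andP[/andP[im mj] al].
have alm : all (fun a => i <= a < m) l.
  have gt_m := order_path_min (rev_trans ltn_trans) ml.
  apply/allP=> a al'; have /andP[-> _] := allP al a al'.
  exact: (allP gt_m).
have [|||||vm IHm] := @count_above_ge i j s m l; rewrite ?(path_sorted ml) //; try lia.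
have := @count_above_cons (i + j) s s m l.
have -> : s - (i + j - m) = s - j + (m - i) by lia.
have B : 0 < (size l).+1 <= s - i by lia.
have := bnd_double (s - j) B.
move: (bnd _ _ _) (count_above _ _ s _) (count_above _ _ m _) IHm => Z X Y IHm /= ZE.
move=> /(_ _ _) H; have {}H : (s - m) * (s - j + (m - i)) + Y <= X by apply: H; lia.
clear - vm IHm ZE H im mj js.
move: (size l) vm IHm ZE => v vm IHm ZE.
have [y yE] : exists y, m = i + v + y by exists (m - i - v); lia.
have [e eE] : exists e, j = m + e by exists (j - m); lia.
have [r rE] : exists r, s = j + r.+1 by exists (s - j).-1; lia.
move: IHm; have -> : 2 * (s - j + (m - i)) - v - 1 = 2 * r + 1 + v + 2 * y by lia.
move: H; have -> : s - m = r + 1 + e by lia.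
have -> : s - j + (m - i) = r + 1 + v + y by lia.
move: ZE; have -> : s - j = r + 1 by lia.
have -> : 2 * (s - i) - v.+1 = 2 * r + 1 + v + 2 * y + 2 * e by lia.
have -> : s - i = r + 1 + e + v + y by lia.
have := leq0n (e * y); clear; lia.
Qed.

Definition upset s (J : {set 'I_s * 'I_s}) : {set 'I_s * 'I_s} :=
  [set P : 'I_s * 'I_s | [exists m in J, (m.1 <= P.1) && (m.2 <= P.2)]].

Definition downset s (J : {set 'I_s * 'I_s}) : {set 'I_s * 'I_s} :=
  [set P : 'I_s * 'I_s | [exists m in J, (P.1 <= m.1) && (P.2 <= m.2)]].

Lemma card_upset_ge s i j (J : {set 'I_s * 'I_s}) : j < s -> 0 < #|J| ->
  (forall m, m \in J -> m.1 + m.2 = i + j /\ i <= m.1 <= j) ->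
  bnd (s - i) (s - j) #|J| <= #|upset J|.
Proof.
(* On the antidiagonal the first exponent determines the monomial, so a decreasing list of first
   exponents encodes [J]. *)
move=> js J0 JP; pose l := sort geq [seq (m.1 : nat) | m : 'I_s * 'I_s in J].
have sl : size l = #|J| by rewrite size_sort size_map -cardE.
have mem_l a : (a \in l) = [exists m in J, m.1 == a :> nat].
  rewrite mem_sort; apply/imageP/exists_inP => [[m mJ ->]|[m mJ /eqP <-]].
    by exists m.
  by exists m.
have -> : #|upset J| = count_above (i + j) s s l.
  rewrite -sum1_card big_mkcond /count_above big_mkord.
  under [RHS]eq_bigr do rewrite big_mkord.
  rewrite pair_bigA; apply: eq_bigr => P _ /=; rewrite inE.
  suff -> : has (fun a => (a <= P.1) && (i + j <= P.2 + a)) l =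
     [exists m in J, (m.1 <= P.1) && (m.2 <= P.2)] by case: ifP.
  apply/hasP/exists_inP => [[a]|[m mJ /andP[le1 le2]]].
    rewrite mem_l => /exists_inP[m mJ /eqP <-] /andP[le1 le2].
    exists m => //; move: le1 le2 (JP m mJ).
    by case: m P {mJ} => [[a' ?] [b ?]] [[p ?] [q ?]] /=; lia.
  exists (m.1 : nat); first by rewrite mem_l; apply/exists_inP; exists m.
  move: le1 le2 (JP m mJ).
  by case: m P {mJ} => [[a' ?] [b ?]] [[p ?] [q ?]] /=; lia.
rewrite -sl; apply: bnd_le_count_above => //.
- rewrite gtn_sorted_uniq_geq sort_sorted ?andbT; last by move=> a b; apply: leq_total.
  rewrite sort_uniq map_inj_in_uniq ?enum_uniq // => -[[a ?] [b ?]] [[a' ?] [b' ?]].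
  rewrite !mem_enum => /JP[/= e _] /JP[/= e' _] /= aa'.
  by apply/eqP; rewrite xpair_eqE -!val_eqE /=; lia.
- by rewrite -size_eq0 sl -lt0n.
by apply/allP=> a; rewrite mem_l => /exists_inP[m /JP[_ ?] /eqP <-].
Qed.

(* The reflection (a, b) -> (s-1-a, s-1-b) exchanges up- and down-sets. *)
Lemma card_downset_ge s i j (J : {set 'I_s * 'I_s}) : i <= j -> j < s -> 0 < #|J| ->
  (forall m, m \in J -> m.1 + m.2 = i + j /\ i <= m.1 <= j) ->
  bnd (j + 1) (i + 1) #|J| <= #|downset J|.
Proof.
move=> ij js J0 JP; pose rv (m : 'I_s * 'I_s) := (rev_ord m.1, rev_ord m.2).
have rvK : involutive rv by case=> a b; rewrite /rv /= !rev_ordK.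
have -> : downset J = rv @^-1: upset (rv @: J).
  apply/setP=> P; rewrite !inE; apply/exists_inP/exists_inP => [[m mJ le]|[_ /imsetP[m mJ ->] le]].
    exists (rv m); first exact: imset_f.
    by case: m P {mJ} le => [[a ?] [b ?]] [[c ?] [d ?]] /=; lia.
  exists m => //.
  by case: m P {mJ} le => [[a ?] [b ?]] [[c ?] [d ?]] /=; lia.
rewrite card_preimset; last exact: inv_inj.
(* The reflected set satisfies [card_upset_ge] with [s - 1 - j] and [s - 1 - i] for [i] and [j]. *)
have -> : j + 1 = s - (s - 1 - j) by lia.
have -> : i + 1 = s - (s - 1 - i) by lia.
rewrite -(card_imset J (inv_inj rvK)).
apply: card_upset_ge; rewrite ?card_imset //; first lia; try exact: inv_inj.
move=> _ /imsetP[m /JP[e le] ->] /=.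
by case: m e le => [[a ?] [b ?]] /=; lia.
Qed.

(** Each new corner X^(j-t) Y^(i+t) adds at most the column above it, of [s - i - t] cells. *)
Lemma card_staircase_le s i j v : i <= j -> j < s -> 0 < v -> v <= j - i + 1 ->
  #|[set P : 'I_s * 'I_s | [exists t : 'I_v, (j - t <= P.1) && (i + t <= P.2)]]|
    <= bnd (s - i) (s - j) v.
Proof.
move=> ij js; case: v => // v _; elim: v => [|v IH] vl.
  rewrite bnd1 mulnC -(card_geq_ord s i) -(card_geq_ord s j) -cardsX.
  apply/subset_leq_card/subsetP=> P; rewrite !inE => /existsP[t].
  by rewrite ord1 subn0 addn0.
rewrite bndS //; apply: leq_trans (leq_add (IH _) (leqnn _)); last lia.
pose C := setX [set p : 'I_s | p == j - v.+1 :> nat] [set q : 'I_s | i + v.+1 <= q].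
have : #|C| <= s - i - v.+1.
  rewrite cardsX card_geq_ord subnDA -[X in _ <= X]mul1n leq_mul2r; apply/orP; right.
  apply/card_le1_eqP=> p q; rewrite !inE => /eqP ep /eqP eq.
  by apply: val_inj; rewrite /= ep eq.
rewrite -(leq_add2l #|[set P : 'I_s * 'I_s | [exists t : 'I_v.+1, (j - t <= P.1) && (i + t <= P.2)]]|).
apply: leq_trans; apply: leq_trans (leq_card_setU _ _).
apply/subset_leq_card/subsetP=> P; rewrite !inE => /existsP[[t tv] /= /andP[le1 le2]].
have [in_new|ne] := boolP [&& P.1 == j - v.+1 :> nat & i + v.+1 <= P.2].
  by rewrite orbT.
rewrite orbF; apply/existsP.
(* A cell above the newest corner but outside its column is already above the previous corner, hence
   the cap at [v]. *)
have tv' : minn t v < v.+1 by lia.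
exists (Ordinal tv') => /=.
by case: P le1 le2 ne => [[a ?] [b ?]] /=; lia.
Qed.

End Counting.

(** * Monomials in the deg-lex window from X^j Y^i to X^i Y^j *)

Section Window.
Variables (s i j v : nat) (J : {set 'I_s * 'I_s}).
Hypotheses (hij : (i <= j)) (hjs : (j < s)) (hv : (0 < v)) (hJ : #|J| = v).
Hypothesis winJ : forall m, m \in J -> (key j i <= key m.1 m.2 < (key i j).+1).

Lemma window_antidiag m : m \in J -> (m.1 + m.2 = i + j /\ i <= m.1 <= j).
Proof.
move/winJ; rewrite ltnS !key_le /deglex_le.
by case: m => [[a ?] [b ?]] /=; lia.
Qed.

Lemma window_upset : (bnd (s - i) (s - j) v <= #|upset J|).
Proof. by rewrite -hJ card_upset_ge ?hJ //; apply: window_antidiag. Qed.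

Lemma window_downset : (bnd (j + 1) (i + 1) v <= #|downset J|).
Proof. by rewrite -hJ card_downset_ge ?hJ //; apply: window_antidiag. Qed.
End Window.

Lemma card_window s i j : (i <= j) -> (j < s) ->
  (#|[set m : 'I_s * 'I_s | (key m.1 m.2 < (key i j).+1)]| -
   #|[set m : 'I_s * 'I_s | (key m.1 m.2 < key j i)]| = j - i + 1).
Proof.
move=> ij js; set A := [set m | _]; set B := [set m | _].
have BA : B \subset A.
  apply/subsetP=> m; rewrite !inE => lt; rewrite (leq_trans lt) //.
  by rewrite leqW // key_le /deglex_le; lia.
have -> : (#|A| - #|B| = #|A :\: B|) by rewrite cardsD (setIidPr BA).
have lt1 (t : 'I_(j - i + 1)) : (j - t < s) by lia.
have lt2 (t : 'I_(j - i + 1)) : (i + t < s) by have := ltn_ord t; lia.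
pose f t : 'I_s * 'I_s := (Ordinal (lt1 t), Ordinal (lt2 t)).
have f_inj : injective f.
  by move=> t u [_ /eqP]; rewrite eqn_add2l => /eqP /val_inj.
rewrite -[RHS]card_ord -cardsT -(card_imset _ f_inj); apply: eq_card => -[[a ha] [b hb]].
rewrite !inE -leqNgt ltnS !key_le /deglex_le /=.
apply/idP/imsetP => [le|[t _ [-> ->]]]; last by have := ltn_ord t; lia.
have bi : (b - i < j - i + 1) by lia.
by exists (Ordinal bi) => //; apply/eqP; rewrite xpair_eqE -!val_eqE /=; lia.
Qed.

(** * Quotients and coordinate projections as matrices *)

Section Matrices.
Local Open Scope ring_scope.
Variables (F : fieldType) (n : nat).

(** [cokermx X] realises the quotient by [X]; this makes [lead U] the complement of
    [jumps (cokermx U)]. *)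
Lemma submx_cokermx (m1 m2 m3 : nat) (A : 'M[F]_(m1, n)) (B : 'M[F]_(m2, n))
    (X : 'M[F]_(m3, n)) :
  (A *m cokermx X <= B *m cokermx X)%MS = (A <= B + X)%MS.
Proof.
apply/submxP/sub_addsmxP => [[y e]|[[y z] /= ->]].
  have : (A - y *m B <= X)%MS by rewrite submxE mulmxBl e mulmxA subrr.
  by case/submxP=> z ez; exists (y, z); rewrite /= -ez addrC subrK.
by exists y; rewrite mulmxDl -!mulmxA mulmx_coker mulmx0 addr0 mulmxA.
Qed.

(** The projection onto the support. It fixes [G] and commutes with multiplication by evaluation
    vectors, and its rank bounds the support size from below. *)
Definition suppmx (v : nat) (G : 'M[F]_(v, n)) : 'M[F]_n :=
  diag_mx (\row_k (k \in mxsupp G)%:R).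

Lemma rank_suppmx v (G : 'M[F]_(v, n)) : (\rank (suppmx G) <= #|mxsupp G|)%N.
Proof.
have sub : (suppmx G <= \sum_(k in mxsupp G) <<delta_mx 0 k : 'rV[F]_n>>)%MS.
  apply/row_subP=> k; rewrite row_diag_mx mxE.
  case: (boolP (k \in _)) => [kG|_]; last by rewrite scale0r sub0mx.
  by rewrite scale1r (sumsmx_sup k) ?genmxE.
apply: leq_trans (mxrankS sub) _.
apply: leq_trans (mxrank_sum_leqif _) _ => /=.
rewrite -sum1_card leq_sum // => k _.
by rewrite genmxE mxrank_delta.
Qed.

Lemma mul_suppmx v (G : 'M[F]_(v, n)) : G *m suppmx G = G.
Proof.
apply/matrixP=> r k; rewrite mul_mx_diag !mxE inE.
case: existsP => [_|no]; first by rewrite mulr1.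
rewrite mulr0; apply/esym/eqP; apply: contraT => Gk; case: no; by exists r.
Qed.

Lemma diag_mxC p q : diag_mx p *m diag_mx q = diag_mx q *m diag_mx p :> 'M[F]_n.
Proof. by rewrite !mulmx_diag; congr diag_mx; apply/rowP=> k; rewrite !mxE mulrC. Qed.

End Matrices.

(** * The deg-lex flag of evaluation codes *)

Section Codes.
Local Open Scope ring_scope.
Variables (F : finFieldType) (S1 S2 : {set F}) (s : nat).
Hypotheses (hS1 : #|S1| = s) (hS2 : #|S2| = s).
Let n := npts S1 S2.
Let px (k : 'I_n) : F := (enum_val k : F * F).1.
Let py (k : 'I_n) : F := (enum_val k : F * F).2.
Let T : finType := ('I_s * 'I_s)%type.
Let kT (m : T) : nat := key m.1 m.2.
Local Notation ev := (evmono S1 S2).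

Definition evpoly (g h : {poly F}) : 'rV[F]_n := \row_k (g.[px k] * h.[py k]).

Definition initcode (t : nat) : 'M[F]_n :=
  evcode S1 S2 [pred m : 'I_s * 'I_s | (key m.1 m.2 < t)%N].
Local Notation W := initcode.

Lemma px_in k : px k \in S1.
Proof. by have := enum_valP k; rewrite inE => /andP[]. Qed.

Lemma py_in k : py k \in S2.
Proof. by have := enum_valP k; rewrite inE => /andP[]. Qed.

Lemma pxy_inj k l : px k = px l -> py k = py l -> k = l.
Proof.
move=> ex ey; apply: enum_val_inj.
by rewrite [LHS]surjective_pairing [RHS]surjective_pairing; congr (_, _).
Qed.

Lemma npts_sqr : npts S1 S2 = (s ^ 2)%N.
Proof. by rewrite /npts cardsX hS1 hS2. Qed.

Lemma evpoly_sub (m : nat) (V : 'M[F]_(m, n)) (g h : {poly F}) :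
  (forall a b, g`_a != 0 -> h`_b != 0 -> (ev a b <= V)%MS) ->
  (evpoly g h <= V)%MS.
Proof.
move=> sub.
have -> : evpoly g h =
    \sum_(a < size g) \sum_(b < size h) (g`_a * h`_b) *: ev a b.
  apply/rowP=> k; rewrite !mxE !horner_coef mulr_suml summxE.
  apply: eq_bigr => a _; rewrite mulr_sumr summxE; apply: eq_bigr => b _.
  by rewrite !mxE -/(px k) -/(py k) mulrACA.
apply: summx_sub => a _; apply: summx_sub => b _.
have [->|ga] := eqVneq g`_a 0; first by rewrite mul0r scale0r sub0mx.
have [->|hb] := eqVneq h`_b 0; first by rewrite mulr0 scale0r sub0mx.
exact/scalemx_sub/sub.
Qed.

(* The remainder of 'X^a modulo the annihilator of S. *)
Lemma reduce_exp (S : {set F}) a : #|S| = s ->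
  exists2 r : {poly F}, (size r <= minn s a.+1)%N & {in S, forall x, r.[x] = x ^+ a}.
Proof.
move=> cS; pose g := \prod_(x <- enum S) ('X - x%:P).
have sg : size g = s.+1 by rewrite size_prod_XsubC -cardE cS.
exists ('X^a %% g).
  rewrite leq_min; apply/andP; split.
    by rewrite -ltnS -sg ltn_modp -size_poly_gt0 sg.
  by rewrite (leq_trans (leq_modp _ _)) // size_polyXn.
move=> x xS; have -> : x ^+ a = ('X^a).[x] by rewrite hornerXn.
rewrite [in RHS](divp_eq 'X^a g) hornerD hornerM.
suff /rootP -> : root g x by rewrite mulr0 add0r.
by rewrite root_prod_XsubC mem_enum.
Qed.

Lemma coef_neq0_lt (g : {poly F}) a : g`_a != 0 -> (a < size g)%N.
Proof. by apply: contraNltn => /(nth_default 0) ->. Qed.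

Lemma initcode_mono t u : (t <= u)%N -> (W t <= W u)%MS.
Proof.
move=> tu; apply/sumsmx_subP => m; rewrite inE => mt.
by apply: (sumsmx_sup m) => //; rewrite inE (leq_trans mt).
Qed.

(** For exponents beyond [s] as well: reduction modulo the annihilators of [S1] and [S2] only lowers
    exponents, hence keys. *)
Lemma evmono_initcode a b t : (key a b < t)%N -> (ev a b <= W t)%MS.
Proof.
move=> lt_t.
have [r rs rE] := reduce_exp a hS1; have [u us uE] := reduce_exp b hS2.
have -> : ev a b = evpoly r u.
  by apply/rowP=> k; rewrite !mxE rE ?uE // ?px_in ?py_in.
apply: evpoly_sub => c d /coef_neq0_lt rc /coef_neq0_lt ud.
have cs : (c < s)%N by move: rs; rewrite leq_min; lia.
have ds : (d < s)%N by move: us; rewrite leq_min; lia.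
apply: (sumsmx_sup (Ordinal cs, Ordinal ds)); last by rewrite genmxE.
rewrite inE /= (leq_ltn_trans _ lt_t) // leq_key //.
  by move: rs; rewrite leq_min; lia.
by move: us; rewrite leq_min; lia.
Qed.

Lemma initcode_sub (m : nat) (V : 'M[F]_(m, n)) t :
  (forall p : T, (kT p < t)%N -> (ev p.1 p.2 <= V)%MS) -> (W t <= V)%MS.
Proof. by move=> sub; apply/sumsmx_subP => p pt; rewrite genmxE sub. Qed.

Lemma initcode0 : W 0 = 0.
Proof. by apply/eqP; rewrite -submx0; apply: initcode_sub. Qed.

Lemma initcodeS (m : T) : (W (kT m).+1 <= W (kT m) + ev m.1 m.2)%MS.
Proof.
apply: initcode_sub => p; rewrite ltnS leq_eqVlt => /predU1P[/keyT_inj ->|lt].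
  exact: addsmxSr.
by rewrite (submx_trans _ (addsmxSl _ _)) // evmono_initcode.
Qed.

Lemma initcodeS_id t : (forall m : T, kT m != t) -> (W t.+1 <= W t)%MS.
Proof.
move=> no; apply: initcode_sub => p; rewrite ltnS leq_eqVlt (negPf (no p)).
exact: evmono_initcode.
Qed.

Definition rootpoly (S : seq F) : {poly F} := \prod_(x <- S) ('X - x%:P).

(* By Lagrange interpolation, since [key s s] exceeds all keys of Delta(s,s). *)
Lemma initcode_full : (1%:M <= W (key s s))%MS.
Proof.
apply/row_subP=> k; rewrite row1.
pose g S (x : F) := rootpoly (enum (S :\ x)).
have gs (S : {set F}) x : #|S| = s -> x \in S -> size (g S x) = s.
  by move=> cS xS; rewrite size_prod_XsubC -cardE -cS [RHS](cardsD1 x) xS.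
have gE (S : {set F}) x y : y \in S -> ((g S x).[y] == 0) = (y != x).
  by move=> yS; rewrite -[_ == 0]/(root _ _) root_prod_XsubC mem_enum !inE yS andbT.
set c := (g S1 (px k)).[px k] * (g S2 (py k)).[py k].
have c0 : c != 0 by rewrite mulf_neq0 // gE ?px_in ?py_in ?eqxx.
have -> : delta_mx 0 k = c^-1 *: evpoly (g S1 (px k)) (g S2 (py k)).
  apply/rowP=> l; rewrite !mxE; have [->|] := eqVneq l k; first by rewrite mulVf.
  move=> lk /=; apply/esym/eqP; rewrite !mulf_eq0 invr_eq0 (negPf c0) /=.
  rewrite !gE ?px_in ?py_in // -negb_and; apply: contra lk => /andP[/eqP e1 /eqP e2].
  exact/eqP/pxy_inj.
apply: scalemx_sub; apply: evpoly_sub => a b /coef_neq0_lt + /coef_neq0_lt.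
rewrite !gs ?px_in ?py_in // => la lb.
exact/evmono_initcode/(keyT_lt (Ordinal la, Ordinal lb)).
Qed.

Lemma initcodeM_sub (m p : nat) (D : 'M[F]_(n, p)) (V : 'M[F]_(m, p)) t :
  (forall P : T, (kT P < t)%N -> (ev P.1 P.2 *m D <= V)%MS) ->
  (W t *m D <= V)%MS.
Proof.
move=> sub; have : (W t <= kermx (D *m cokermx V))%MS.
  by apply: initcode_sub => P /sub PV; apply/sub_kermxP; rewrite mulmxA; apply/eqP; rewrite -submxE.
by move/sub_kermxP; rewrite mulmxA => /eqP; rewrite -submxE.
Qed.

Lemma evmono_diag a b c d : ev a b *m diag_mx (ev c d) = ev (a + c) (b + d).
Proof. by apply/rowP=> k; rewrite mul_mx_diag !mxE mulrACA !exprD. Qed.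

Lemma initcode_diag a b c d :
  (W (key a b) *m diag_mx (ev c d) <= W (key (a + c) (b + d)))%MS.
Proof.
apply: initcodeM_sub => P lt; rewrite evmono_diag evmono_initcode //.
by rewrite ltn_keyD.
Qed.

(** * Jumps and leading monomials along the flag *)

(* Monomials at which the flag [W t *m D] jumps. For [D = U^T]
   these are the monomials that are, for some word of [U], the deg-lex first one
   with nonzero pairing. *)
Definition jumps (p : nat) (D : 'M[F]_(n, p)) : {set T} :=
  [set m : T | ~~ (ev m.1 m.2 *m D <= W (kT m) *m D)%MS].

(** Each key adds at most one vector to the flag, so the rank grows by one exactly at the keys of
    jumps. *)
Lemma rank_initcodeM (p : nat) (D : 'M[F]_(n, p)) t :
  \rank (W t *m D) = (\sum_(m in jumps D) (kT m < t))%N.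
Proof.
apply/eqP; rewrite eqn_leq; apply/andP; split; last first.
  apply: (@count_jumps_le _ kT (fun u => \rank (W u *m D)) (jumps D) t).
  - by move=> m m' _ _; apply: keyT_inj.
  - by move=> u; rewrite mxrankS // submxMr // initcode_mono.
  move=> m; rewrite inE ltnNge; apply: contra => le.
  have sub : (W (kT m) *m D <= W (kT m).+1 *m D)%MS by rewrite submxMr // initcode_mono.
  have [_ e] := mxrank_leqif_sup sub.
  apply: (@submx_trans _ _ _ _ _ _ (W (kT m).+1 *m D)).
    by rewrite submxMr // evmono_initcode.
  by rewrite -e eqn_leq mxrankS //= le.
have := @count_jumps_ge _ kT (fun t => \rank (W t *m D)) (jumps D) t.
rewrite initcode0 mul0mx mxrank0 add0n; apply=> u.
case: (pickP [pred m : T | kT m == u]) => [m /= /eqP <-|no]; last first.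
  rewrite (leq_trans _ (leq_addr _ _)) // mxrankS // submxMr // initcodeS_id // => m.
  by have := no m => /= ->.
have sub : (W (kT m).+1 *m D <= W (kT m) *m D + ev m.1 m.2 *m D)%MS.
  by rewrite (submx_trans (submxMr _ (initcodeS m))) // addsmxMr.
have [mJ|mJ] := boolP (m \in jumps D).
  rewrite [X in (_ <= _ + X)%N](bigD1 m mJ) /= eqxx.
  apply: leq_trans (mxrankS sub) _; apply: leq_trans (mxrank_adds_leqif _ _) _.
  by rewrite leq_add2l (leq_trans (rank_leq_row _)).
move: mJ; rewrite inE negbK => mJ; rewrite (leq_trans _ (leq_addr _ _)) // mxrankS //.
by rewrite (submx_trans sub) // addsmx_sub submx_refl.
Qed.

Lemma card_jumps (p : nat) (D : 'M[F]_(n, p)) : #|jumps D| = \rank D.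
Proof.
rewrite -(count_keys_all (k := kT) (t := key s s)); last by move=> m _; apply: keyT_lt.
rewrite -rank_initcodeM; apply/eqP; rewrite eqn_leq mxrankM_maxr.
by rewrite -{1}[D]mul1mx mxrankS // submxMr // initcode_full.
Qed.

(* The flag [W] has n = s^2 jumps, so it jumps at each of the s^2 monomials. *)
Lemma evmono_notin_initcode (m : T) : ~~ (ev m.1 m.2 <= W (kT m))%MS.
Proof.
suff /setP/(_ m) : jumps 1%:M = setT by rewrite !inE !mulmx1.
apply/eqP; rewrite eqEcard subsetT card_jumps mxrank1 cardsT card_prod !card_ord.
by rewrite /n npts_sqr mulnn /=.
Qed.

Lemma rank_initcode t : \rank (W t) = #|[set m : T | (kT m < t)%N]|.
Proof.
rewrite -[W t]mulmx1 rank_initcodeM -sum1dep_card big_mkcond [RHS]big_mkcond /=.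
apply: eq_bigr => m _; rewrite inE !mulmx1 evmono_notin_initcode.
by case: ifP.
Qed.

(* The leading monomials of the nonzero elements of [U]: [ev m] is congruent
   modulo smaller monomials to an element of [U]. *)
Definition lead (p : nat) (U : 'M[F]_(p, n)) : {set T} :=
  [set m : T | (ev m.1 m.2 <= W (kT m) + U)%MS].

Lemma card_lead (p : nat) (U : 'M[F]_(p, n)) : #|lead U| = \rank U.
Proof.
have -> : lead U = ~: jumps (cokermx U).
  by apply/setP=> m; rewrite !inE negbK submx_cokermx.
rewrite cardsCs setCK card_jumps mxrank_coker card_prod !card_ord mulnn.
by rewrite -npts_sqr subKn // rank_leq_col.
Qed.

(** Footprint bound. If [ev m] is w + u with w smaller and u in [U], multiplying by P/m keeps w
    below P and u inside [suppmx U], so P is leading for [suppmx U]. *)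
Lemma upset_lead v (U : 'M[F]_(v, n)) : (#|upset (lead U)| <= #|mxsupp U|)%N.
Proof.
apply: leq_trans (rank_suppmx U); rewrite -card_lead subset_leq_card //.
apply/subsetP=> P; rewrite !inE => /existsP[m /and3P[]].
rewrite inE => /sub_addsmxP[[w u] /= e] le1 le2.
have := evmono_diag m.1 m.2 (P.1 - m.1) (P.2 - m.2); rewrite !subnKC // => <-.
rewrite e mulmxDl addmx_sub_adds //.
  have := initcode_diag m.1 m.2 (P.1 - m.1) (P.2 - m.2); rewrite !subnKC //.
  by apply: submx_trans; rewrite submxMr // submxMl.
by rewrite -{1}(mul_suppmx U) -!mulmxA diag_mxC !mulmxA submxMl.
Qed.

(** Feng-Rao bound. If P is not a jump of [suppmx U], multiplying the dependence by m/P and pairing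
    with [U] shows that m is not a jump of [U^T]. *)
Lemma downset_jumps v (U : 'M[F]_(v, n)) :
  (#|downset (jumps U^T)| <= #|mxsupp U|)%N.
Proof.
apply: leq_trans (rank_suppmx U); rewrite -card_jumps subset_leq_card //.
apply/subsetP=> P; rewrite inE => /existsP[m /and3P[mJ le1 le2]].
move: mJ; rewrite !inE; apply: contra => /submxP[w e].
have suppT : suppmx U *m U^T = U^T.
  by rewrite -[RHS](congr1 trmx (mul_suppmx U)) trmx_mul tr_diag_mx.
have := evmono_diag P.1 P.2 (m.1 - P.1) (m.2 - P.2); rewrite !subnKC // => <-.
rewrite -{1}suppT mulmxA -(mulmxA (ev _ _)) diag_mxC !mulmxA e -!mulmxA.
rewrite (mulmxA (suppmx U)) [suppmx U *m diag_mx _]diag_mxC -!mulmxA suppT !mulmxA submxMr //.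
have := initcode_diag P.1 P.2 (m.1 - P.1) (m.2 - P.2); rewrite !subnKC //.
by apply: submx_trans; rewrite -mulmxA submxMl.
Qed.

(** If m is below [t0], the element of [U] it leads lies in [W t0], so is zero; if m is not below
    [t1], then [U] lies in [W (kT m)]. Either way [ev m] falls into [W (kT m)]. *)
Lemma lead_window v (U : 'M[F]_(v, n)) t0 t1 : (U <= W t1)%MS ->
  (U :&: W t0 <= (0 : 'M[F]_n))%MS -> forall m, m \in lead U -> (t0 <= kT m < t1)%N.
Proof.
move=> U1 U0 m; rewrite inE => mU; have nm := evmono_notin_initcode m.
apply/andP; split; rewrite leqNgt; apply: contra nm => lt.
  have /sub_addsmxP[[w u] /= e] := mU.
  have : (u *m U <= (0 : 'M[F]_n))%MS.
    apply: submx_trans U0; rewrite sub_capmx submxMl /=.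
    have -> : u *m U = ev m.1 m.2 - w *m W (kT m) by rewrite e addrC addKr.
    rewrite addmx_sub ?evmono_initcode // -mulNmx mulmx_sub //.
    by rewrite initcode_mono // ltnW.
  by rewrite submx0 => /eqP u0; rewrite e u0 addr0 submxMl.
apply: submx_trans mU _; rewrite addsmx_sub submx_refl /=.
by rewrite (submx_trans U1) // initcode_mono.
Qed.

(** Below [t0] the pairing with [U] vanishes. Since [U] avoids the dual of [W t1], the matrix
    [W t1 *m U^T] has full rank, so no jump remains from [t1] on. *)
Lemma jumps_window v (U : 'M[F]_(v, n)) t0 t1 : row_free U ->
  (U <= dualcode (W t0))%MS -> (U :&: dualcode (W t1) <= (0 : 'M[F]_n))%MS ->
  forall m, m \in jumps U^T -> (t0 <= kT m < t1)%N.
Proof.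
move=> fU U0 U1 m; rewrite inE => mJ.
apply/andP; split; rewrite leqNgt; apply: contra mJ => lt.
  have WU : W t0 *m U^T = 0.
    by apply: trmx_inj; rewrite trmx_mul trmxK trmx0; apply/sub_kermxP.
  by rewrite (submx_trans (submxMr _ (evmono_initcode lt))) // WU sub0mx.
have full : row_full (W t1 *m U^T).
  rewrite /row_full -mxrank_tr trmx_mul trmxK.
  have := mxrank_mul_ker U (W t1)^T.
  move: U1; rewrite submx0 => /eqP ->; rewrite mxrank0 addn0 => ->.
  exact: fU.
apply: (@submx_trans _ _ _ _ _ _ (W t1 *m U^T)); first exact: submx_full.
by rewrite submxMr // initcode_mono.
Qed.

Lemma monic_subXn_coef (g : {poly F}) a c :
  g \is monic -> size g = a.+1 -> (g - 'X^a)`_c != 0 -> (c < a)%N.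
Proof.
move=> /monicP; rewrite lead_coefE coefB coefXn => g1 sg; rewrite sg /= in g1.
case: (ltngtP c a) => // [ac|->]; last by rewrite g1 subrr eqxx.
by rewrite nth_default ?sg // subr0 eqxx.
Qed.

Lemma evpoly_monic (g h : {poly F}) a b : g \is monic -> h \is monic ->
  size g = a.+1 -> size h = b.+1 -> (evpoly g h - ev a b <= W (key a b))%MS.
Proof.
move=> g1 h1 sg sh.
have -> : evpoly g h - ev a b = evpoly (g - 'X^a) h + evpoly 'X^a (h - 'X^b).
  by apply/rowP=> k; rewrite !mxE !hornerE; ring.
apply: addmx_sub; apply: evpoly_sub => c d.
  move=> /(monic_subXn_coef g1 sg) ca /coef_neq0_lt; rewrite sh => db.
  by rewrite evmono_initcode // key_lt /deglex_lt; lia.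
rewrite coefXn; case: (eqVneq c a) => [->|_]; last by rewrite eqxx.
move=> _ /(monic_subXn_coef h1 sh) db.
by rewrite evmono_initcode // key_lt /deglex_lt; lia.
Qed.

(** * A subspace attaining the primal bound *)

Section Witness.
Variables (i j v : nat).
Hypotheses (hij : (i <= j)%N) (hjs : (j < s)%N) (hv : (v <= j - i + 1)%N).

Let g (t : nat) := rootpoly (take (j - t) (enum S1)).
Let h (t : nat) := rootpoly (take (i + t) (enum S2)).

(** Row [t] has leading monomial X^(j-t) Y^(i+t) and vanishes at the first [j - t] elements of [S1]
    and the first [i + t] of [S2]. *)
Definition witness : 'M[F]_(v, n) := \matrix_(t < v) evpoly (g t) (h t).

Lemma witness_lead (t : 'I_v) :
  (row t witness - ev (j - t) (i + t) <= W (key (j - t) (i + t)))%MS.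
Proof.
rewrite rowK; apply: evpoly_monic; rewrite ?monic_prod_XsubC //.
  by rewrite size_prod_XsubC size_takel // -cardE hS1; lia.
by rewrite size_prod_XsubC size_takel // -cardE hS2; have := ltn_ord t; lia.
Qed.

Lemma witness_sub_key (t : 'I_v) u : (key (j - t) (i + t) < u)%N ->
  (row t witness <= W u)%MS.
Proof.
move=> lt; rewrite -[row t _](subrK (ev (j - t) (i + t))) addmx_sub //.
  by rewrite (submx_trans (witness_lead t)) // initcode_mono // ltnW.
exact: evmono_initcode.
Qed.

Lemma witness_sub : (witness <= W (key i j).+1)%MS.
Proof.
apply/row_subP=> t; apply: witness_sub_key; rewrite ltnS key_le /deglex_le.
by have := ltn_ord t; lia.
Qed.

(** Leading keys increase with the row index, so the last nonzero coefficient fixes the leading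
    monomial, whose key is at least [key j i]. *)
Lemma witness_indep (c : 'rV_v) : (c *m witness <= W (key j i))%MS -> c = 0.
Proof.
move=> cW; apply/eqP; apply: contraT => /eqP c0.
have [t1 ct1] : exists t, c 0 t != 0.
  apply/existsP; apply: contraT; rewrite negb_exists => /forallP no.
  by case: c0; apply/rowP=> t; rewrite mxE; apply/eqP; have := no t; rewrite negbK.
have [t ct tmax] := @arg_maxnP _ t1 (fun t => c 0 t != 0) (@nat_of_ord v) ct1.
have ja : (j - t < s)%N by lia.
have ib : (i + t < s)%N by have := ltn_ord t; lia.
have := evmono_notin_initcode (Ordinal ja, Ordinal ib).
rewrite /kT /=; set K := key (j - t) (i + t); set E := ev _ _.
suff -> : (E <= W K)%MS by [].
have wE : E = row t witness - (row t witness - E) by rewrite opprB addrC subrK.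
rewrite wE addmx_sub // ?eqmx_opp ?witness_lead //.
suff : (c 0 t *: row t witness <= W K)%MS by rewrite eqmx_scale.
have -> : c 0 t *: row t witness =
    c *m witness - \sum_(u < v | u != t) c 0 u *: row u witness.
  by rewrite mulmx_sum_row (bigD1 t) //= addrK.
rewrite addmx_sub // ?eqmx_opp.
  rewrite (submx_trans cW) // initcode_mono // key_le /deglex_le.
  by have := ltn_ord t; lia.
apply: summx_sub => u ut; have [->|cu] := eqVneq (c 0 u) 0.
  by rewrite scale0r sub0mx.
apply: scalemx_sub; apply: witness_sub_key.
have ltut : (u < t)%N by rewrite ltn_neqAle; move: ut; rewrite -val_eqE => -> /=; apply: tmax.
by rewrite /K key_lt /deglex_lt; have := ltn_ord t; lia.
Qed.

Lemma witness_row_free : row_free witness.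
Proof. by apply: inj_row_free => c c0; apply: witness_indep; rewrite c0 sub0mx. Qed.

Lemma witness_cap : (witness :&: W (key j i) <= (0 : 'M[F]_n))%MS.
Proof.
apply/rV_subP=> u; rewrite sub_capmx => /andP[/submxP[c ->]].
by move/witness_indep => ->; rewrite mul0mx sub0mx.
Qed.

Lemma rootpoly_take_neq0 (S : {set F}) a x : x \in S ->
  ((rootpoly (take a (enum S))).[x] != 0) = (a <= index x (enum S))%N.
Proof.
move=> xS; rewrite -[_ == 0]/(root _ _) root_prod_XsubC.
by rewrite in_take ?mem_enum // -leqNgt.
Qed.

Lemma index_enum_lt (S : {set F}) x : #|S| = s -> x \in S -> (index x (enum S) < s)%N.
Proof. by move=> <- xS; rewrite cardE index_mem mem_enum. Qed.

Lemma witness_supp : (0 < v)%N -> (#|mxsupp witness| <= bnd (s - i) (s - j) v)%N.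
Proof.
move=> v0; apply: leq_trans (card_staircase_le hij hjs v0 hv).
(* In terms of positions in the two enumerations, the support lies in a staircase. *)
pose f (k : 'I_n) := (Ordinal (index_enum_lt hS1 (px_in k)),
                      Ordinal (index_enum_lt hS2 (py_in k))).
have f_inj : injective f.
  move=> k l [e1 e2]; apply: pxy_inj.
    by rewrite -(nth_index 0 (_ : px k \in enum S1)) ?mem_enum ?px_in // e1 nth_index // mem_enum px_in.
  by rewrite -(nth_index 0 (_ : py k \in enum S2)) ?mem_enum ?py_in // e2 nth_index // mem_enum py_in.
rewrite -(card_imset _ f_inj); apply/subset_leq_card/subsetP=> _ /imsetP[k + ->].
rewrite !inE => /existsP[t]; rewrite !mxE mulf_eq0 negb_or => /andP[].
rewrite !rootpoly_take_neq0 ?px_in ?py_in // => le1 le2.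
by apply/existsP; exists t; rewrite /= le1.
Qed.

End Witness.

End Codes.

(** * Relative generalized Hamming weights *)

(** [b <= n] covers the default value of the minimum. *)
Lemma relM_ge (F : finFieldType) n (C1 C2 : 'M[F]_n) v b : b <= n ->
  (forall G : 'M[F]_(v, n), row_free G -> (G <= C1)%MS ->
     (G :&: C2 <= (0%R : 'M[F]_n))%MS -> b <= #|mxsupp G|) ->
  b <= relM C1 C2 v.
Proof.
move=> bn bG; apply: (big_ind (fun x => b <= x)) => // [x y bx by_|G /and3P[]].
  by rewrite leq_min bx.
exact: bG.
Qed.

Lemma relM_le (F : finFieldType) n (C1 C2 : 'M[F]_n) v (G : 'M[F]_(v, n)) :
  row_free G -> (G <= C1)%MS -> (G :&: C2 <= (0%R : 'M[F]_n))%MS ->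
  relM C1 C2 v <= #|mxsupp G|.
Proof.
move=> fG G1 G2; rewrite /relM; have : G \in index_enum _ by rewrite mem_index_enum.
elim: (index_enum _) => // H r IH; rewrite big_cons inE => /predU1P[<-|/IH le].
  by rewrite fG G1 G2 geq_minl.
by case: ifP => // _; rewrite geq_min le orbT.
Qed.

Section Bounds.
Variables (F : finFieldType) (S1 S2 : {set F}) (s i j v : nat).
Hypotheses (hS1 : #|S1| = s) (hS2 : #|S2| = s).
Hypotheses (hij : i <= j) (hjs : j < s) (hv : 0 < v) (hvl : v <= j - i + 1).

Let C1 := evcode S1 S2 [pred m : 'I_s * 'I_s | deglex_le m.1 m.2 i j].
Let C2 := evcode S1 S2 [pred m : 'I_s * 'I_s | deglex_lt m.1 m.2 j i].

Lemma code1E : C1 = initcode S1 S2 s (key i j).+1.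
Proof. by apply: eq_bigl => m; rewrite !inE ltnS key_le. Qed.

Lemma code2E : C2 = initcode S1 S2 s (key j i).
Proof. by apply: eq_bigl => m; rewrite !inE key_lt. Qed.

Lemma code_incl : (C2 <= C1)%MS.
Proof.
by rewrite code1E code2E initcode_mono // leqW // key_le /deglex_le addnC eqxx hij orbT.
Qed.

Lemma code_codim : \rank C1 - \rank C2 = j - i + 1.
Proof. by rewrite code1E code2E !rank_initcode // card_window. Qed.

(** Needed for the default value of [relM]. The [witness] supplies [v] monomials in the window,
    whose divisors all lie in Delta(s,s). *)
Lemma wide_support_dual : bnd (j + 1) (i + 1) v <= npts S1 S2.
Proof.
pose G := witness S1 S2 i j v.
have cG : #|lead s G| = v.
  by rewrite card_lead //; apply/eqP/(witness_row_free hS1 hS2 hij hjs hvl).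
apply: leq_trans (window_downset hij hjs hv cG _) _.
  by apply: lead_window => //; [apply: witness_sub | apply: witness_cap].
by rewrite (npts_sqr hS1 hS2) -mulnn -[s in s * _]card_ord -[X in _ * X]card_ord -card_prod max_card.
Qed.

Lemma relM_primal : relM C1 C2 v = bnd (s - i) (s - j) v.
Proof.
have lb (G : 'M[F]_(v, npts S1 S2)) : row_free G ->
    (G <= initcode S1 S2 s (key i j).+1)%MS ->
    (G :&: initcode S1 S2 s (key j i) <= (0%R : 'M[F]_(npts S1 S2)))%MS ->
    bnd (s - i) (s - j) v <= #|mxsupp G|.
  move=> fG G1 G2; apply: leq_trans (upset_lead hS1 hS2 G).
  apply: window_upset => //; first by rewrite card_lead //; apply/eqP.
  exact: lead_window.
have fW := witness_row_free hS1 hS2 hij hjs hvl.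
have W1 := witness_sub hS1 hS2 hij hjs hvl.
have W2 := witness_cap hS1 hS2 hij hjs hvl.
apply/eqP; rewrite code1E code2E eqn_leq; apply/andP; split.
  by apply: leq_trans (witness_supp hS1 hS2 hij hjs hvl hv); apply: relM_le.
apply: relM_ge => [|G]; last exact: lb.
by rewrite (leq_trans (lb _ fW W1 W2)) // -[X in _ <= X]card_ord max_card.
Qed.

Lemma relM_dual : bnd (j + 1) (i + 1) v <= relM (dualcode C2) (dualcode C1) v.
Proof.
rewrite code1E code2E; apply: relM_ge => [|G fG G2 G1]; first exact: wide_support_dual.
apply: leq_trans (downset_jumps hS1 hS2 G).
apply: window_downset => //; first by rewrite card_jumps // mxrank_tr; apply/eqP.
exact: jumps_window.
Qed.

End Bounds.

Theorem mainTheorem5 (F : finFieldType) (S1 S2 : {set F}) (s i j : nat)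
  (hS1 : #|S1| = s) (hS2 : #|S2| = s) (hij : (i <= j)%N) (hjs : (j < s)%N) :
  let L1 := [pred m : 'I_s * 'I_s | deglex_le m.1 m.2 i j] in
  let L2 := [pred m : 'I_s * 'I_s | deglex_lt m.1 m.2 j i] in
  let C1 := evcode S1 S2 L1 in
  let C2 := evcode S1 S2 L2 in
  let l := (j - i + 1)%N in
  [/\ npts S1 S2 = (s ^ 2)%N,
      (C2 <= C1)%MS /\ (\rank C1 - \rank C2)%N = l,
      relM C1 C2 1 = ((s - i) * (s - j))%N,
      (((i + 1) * (j + 1))%N <= relM (dualcode C2) (dualcode C1) 1)%N &
      forall v : nat, (2 <= v <= l)%N ->
        [/\ relM C1 C2 v =
              ((s - i) * (s - j) + \sum_(2 <= t < v.+1) ((s - i) - (t - 1)))%N,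
            relM C1 C2 v = ((s - i) * (s - j + v - 1) - v * (v - 1) %/ 2)%N,
            (((i + 1) * (j + 1) + \sum_(2 <= t < v.+1) ((j + 1) - (t - 1)))%N
               <= relM (dualcode C2) (dualcode C1) v)%N &
            (((i + v) * (j + 1) - v * (v - 1) %/ 2)%N
               <= relM (dualcode C2) (dualcode C1) v)%N]].
Proof.
move=> L1 L2 C1 C2 l.
have l0 : 0 < l by rewrite /l addn1.
split=> [||||v /andP[v2 vl]].
- exact: npts_sqr.
- by split; [exact: code_incl | exact: (code_codim hS1 hS2 hij hjs)].
- by rewrite (relM_primal hS1 hS2 hij hjs (ltn0Sn 0) l0) bnd1.
- by rewrite mulnC -bnd1 (relM_dual hS1 hS2 hij hjs (ltn0Sn 0) l0).
have v0 : 0 < v by apply: ltnW.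
have lbD := relM_dual hS1 hS2 hij hjs v0 vl.
(* The closed form needs [v <= K], for [K] equal to [s - i] and to [j + 1]. *)
have vs : 0 < v <= s - i by rewrite /l in vl; lia.
have vj : 0 < v <= j + 1 by rewrite /l in vl; lia.
split.
- by rewrite relM_primal.
- by rewrite relM_primal // bnd_closed.
- by rewrite (mulnC (i + 1)).
apply: leq_trans lbD; rewrite bnd_closed // mulnC.
by have -> : i + 1 + v - 1 = i + v by lia.
Qed.
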